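(* For every integer $k\ge1$, the maximal order of $\Phi_k(n)$ is $n^k$, i.e. $\limsup_{n\to\infty}\Phi_k(n)/n^k=1$.
   Context: For an integer $k\ge1$ and $n\in\mathbb{N}$, $\Phi_k(n)=|\{(x_1,\dots,x_k)\in(\mathbb{Z}/n\mathbb{Z})^k:\gcd(x_1^2+\cdots+x_k^2,n)=1\}|$. For an arithmetic function $f$ and a non-decreasing function $g$ that is eventually positive, $g$ is a maximal order of $f$ if $\limsup_{n\to\infty}f(n)/g(n)=1$. *)

(* Defs.v *)
From HB Require Import structures.
From mathcomp Require Import all_boot all_order all_algebra.
From mathcomp Require Import all_classical all_reals all_analysis.

Set Implicit Arguments.
Unset Strict Implicit.
Unset Printing Implicit Defensive.

Import Order.TTheory GRing.Theory Num.Theory.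

Local Open Scope classical_set_scope.
Local Open Scope ring_scope.

(* Residue classes mod n are given by their representatives in 'I_n: unlike
   'Z_n, this is also correct for n = 1.  The sum of squares is taken in nat;
   its gcd with n depends only on the residue classes (gcdn_modl). *)
Definition Phi (k n : nat) : nat :=
  #|[set x : {ffun 'I_k -> 'I_n} | coprime (\sum_(i < k) x i ^ 2) n]%SET|.

(* Arithmetic functions live on the positive integers; their value at 0 is
   never constrained.  The limit superior is taken in the extended reals, where
   it always exists. *)
Definition maximal_order (R : realType) (f g : nat -> R) : Prop :=
  [/\ forall m n : nat, (0 < m)%N -> (m <= n)%N -> g m <= g n,
      \forall n \near \oo, 0 < g n
    & limn_esup (fun n => (f n / g n)%:E) = 1%:E].

(* Main.v *)
(** Phi_k(n) <= n^k is immediate.  For p prime and the other coordinates fixed,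
    x_1^2 is determined modulo p by p | x_1^2 + ... + x_k^2, leaving at most two
    choices for x_1; hence Phi_k(p) >= p^k - 2 p^(k-1), and Phi_k(p) / p^k is
    at least 1 - 2/p, which tends to 1 along the primes. *)
Require Import Defs.
From HB Require Import structures.
From mathcomp Require Import all_boot all_order all_algebra.
From mathcomp Require Import all_classical all_reals all_analysis.
From mathcomp Require Import zify.

Import Order.TTheory GRing.Theory Num.Theory.

Local Open Scope ring_scope.

(** For [a <= b], the prime [p] divides [(b - a) * (b + a)], where [b - a < p] and [b + a < 2 * p];
    so [b - a] is 0 or [b + a] is 0 or [p]. *)
Lemma eq_sqr_modp (p a b : nat) : prime p -> (a < p)%N -> (b < p)%N ->
  (a ^ 2 = b ^ 2 %[mod p])%N -> a = b \/ (a + b = p)%N.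
Proof.
move=> p_pr; wlog le_ab : a b / (a <= b)%N => [hw ap bp ab|ap bp /esym/eqP].
  case: (leqP a b) => [le_ab|/ltnW le_ba]; first exact: hw.
  by rewrite addnC; case: (hw b a le_ba bp ap (esym ab)); [left|right].
rewrite eqn_mod_dvd ?leq_sqr// subn_sqr Euclid_dvdM//.
case/orP=> /dvdnP[c]; last first.
  by case: c => [|[|c]]; rewrite ?mulSn; [left|right|]; lia.
by case: c => [|c]; rewrite ?mulSn; [left|]; lia.
Qed.

Lemma Phi_le (k n : nat) : (Phi k n <= n ^ k)%N.
Proof.
by rewrite /Phi (leq_trans (max_card _))// card_ffun !card_ord.
Qed.

Lemma Phi_prime_ge (k p : nat) : prime p ->
  (p ^ k.+1 <= Phi k.+1 p + 2 * p ^ k)%N.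
Proof.
move=> p_pr; rewrite /Phi; set A := finset _.
rewrite -[X in (X <= _)%N](_ : #|{ffun 'I_k.+1 -> 'I_p}| = _)%N; last first.
  by rewrite card_ffun !card_ord.
rewrite -(cardsC A) leq_add2l.
(* The non-coprime tuples will inject into pairs: the last [k] coordinates, and one bit choosing the
   square root. *)
rewrite [leqRHS](_ : _ = #|{: {ffun 'I_k -> 'I_p} * bool}|); last first.
  by rewrite card_prod card_ffun !card_ord card_bool mulnC.
(* The two square roots a and p - a of a class are told apart by a < p - a. *)
pose f (x : {ffun 'I_k.+1 -> 'I_p}) :=
  ([ffun i => x (lift ord0 i)], (x ord0 < p - x ord0)%N).
have f_inj : {in ~: A &, injective f}.
  move=> x y; rewrite !inE ![coprime _ p]coprime_sym !prime_coprime// !negbK.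
  move=> px py [/ffunP fxy bxy].
  have xy i : x (lift ord0 i) = y (lift ord0 i) by have := fxy i; rewrite !ffunE.
  have : (x ord0 ^ 2 = y ord0 ^ 2 %[mod p])%N.
    move: px py; rewrite !big_ord_recl (eq_bigr (fun i => y (lift ord0 i) ^ 2)%N);
      last by move=> i _; rewrite xy.
    rewrite /dvdn => /eqP px /eqP py; apply/eqP.
    by rewrite -(eqn_modDr (\sum_(i < k) y (lift ord0 i) ^ 2)) px py.
  move=> /(eq_sqr_modp _ _ _ p_pr (ltn_ord _) (ltn_ord _)) x0y0.
  (* If the first coordinates [a], [b] satisfy [a + b = p], the bits say [a < b] and [b < a]; they
     agree only when [a = b]. *)
  have {}x0y0 : x ord0 = y ord0 by apply: val_inj; move: x0y0 bxy => /=; lia.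
  by apply/ffunP => i; case: (unliftP ord0 i) => [j|] ->.
by rewrite -(card_in_imset f_inj) max_card.
Qed.

Lemma Phi_ratio_prime_ge (R : realType) (k p : nat) : prime p ->
  1 - 2 / p%:R <= (Phi k.+1 p)%:R / p%:R ^+ k.+1 :> R.
Proof.
move=> p_pr; have p0 : 0 < p%:R :> R by rewrite ltr0n prime_gt0.
rewrite ler_pdivlMr ?exprn_gt0// mulrBl mul1r lerBlDr exprS mulrA mulfVK ?gt_eqF//.
by rewrite -exprS -!natrX -natrM -natrD ler_nat Phi_prime_ge.
Qed.

Theorem theorem6 (R : realType) (k : nat) (hk : (1 <= k)%N) :
  maximal_order (fun n : nat => (Phi k n)%:R : R) (fun n : nat => n%:R ^+ k).
Proof.
split.
- by move=> m n _ mn; rewrite lerXn2r ?nnegrE// ler_nat.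
- by exists 1%N => // n /= n0; rewrite exprn_gt0// ltr0n.
apply/eqP; rewrite eq_le; apply/andP; split.
  apply: (@le_trans _ _ (ereal_sup (range (fun n => ((Phi k n)%:R / n%:R ^+ k : R)%:E)))).
    by apply: ereal_inf_lbound; exists setT => //; exact: filterT.
  apply: ge_ereal_sup => _ [n _ <-]; rewrite lee_fin.
  (* At [n = 0] the quotient is 0: [k] is positive and the inverse of 0 is 0. *)
  have [->|n0] := posnP n; first by rewrite expr0n gtn_eqF// invr0 mulr0.
  by rewrite ler_pdivrMr ?exprn_gt0 ?ltr0n// mul1r -natrX ler_nat Phi_le.
(* The limit superior is the infimum of the suprema over neighbourhoods [V] of infinity; each [V]
   must contain a ratio at least [1 - e]. *)
apply: le_ereal_inf_tmp => _ [V [N _ NV] <-]; apply/lee_subgt0Pr => e e0.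
case: k hk => // k _.
(* Exceeding [N] puts [p] in [V]; exceeding the integer part of [2 / e] gives [2 / p <= e]. *)
have [p] := prime_above (maxn N (Num.truncn (2 / e))).
rewrite gtn_max => /andP[Np ep] p_pr.
apply: (@le_trans _ _ ((Phi k.+1 p)%:R / p%:R ^+ k.+1)%:E); last first.
  by apply: ereal_sup_ubound; exists p => //; apply: NV => /=; exact: ltnW.
rewrite -EFinB lee_fin (le_trans _ (Phi_ratio_prime_ge _ _ _ p_pr))// lerB//.
have p0 : 0 < p%:R :> R by rewrite ltr0n prime_gt0.
rewrite ler_pdivrMr// mulrC -ler_pdivrMr//.
by rewrite (le_trans (ltW (truncnS_gt _)))// ler_nat.
Qed.
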